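(* Let $p$ be an odd prime and let $\mathcal{P}$ be a nontrivial monotone and non-evasive graph property on $2p$ vertices. Then at least one of the graphs $2C_p$, $K_{p,p}$ belongs to $\mathcal{P}$.
   Context: Graphs are finite and simple. A graph property $\mathcal{P}$ on $n$ vertices is a collection of graphs with vertex set $\{1,\ldots,n\}$ (identified with their edge sets) that is closed under isomorphism of graphs. Its complexity $c(\mathcal{P})$ is the minimum $k$ such that some adaptive strategy of questions of the form ''is $\{i,j\}$ an edge of $G$?'' always determines, for every unknown graph $G$ on $\{1,\ldots,n\}$, whether $G\in\mathcal{P}$ using at most $k$ questions. $\mathcal{P}$ is evasive if $c(\mathcal{P})=\binom{n}{2}$, and non-evasive otherwise. $\mathcal{P}$ is monotone if it is closed under removal of edges. $\mathcal{P}$ is trivial if it is empty or consists of all graphs on $\{1,\ldots,n\}$, and nontrivial otherwise. $2C_p$ is the disjoint union of two cycles of length $p$, and $K_{p,p}$ is the complete bipartite graph with both parts of size $p$. *)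

(* Defs.v *)
From mathcomp Require Import all_boot all_fingroup.
From mathcomp Require Import boolp.

Set Implicit Arguments.
Unset Strict Implicit.
Unset Printing Implicit Defensive.

Definition vpair (n : nat) := {e : {set 'I_n} | #|e| == 2}.

(* The vertex set {1, ..., n} is rendered as 'I_n. *)
Definition graph (n : nat) := {set vpair n}.

Definition adj n (G : graph n) (i j : 'I_n) : bool :=
  [exists e in G, val e == [set i; j]].

Definition isomorphic n (G H : graph n) : Prop :=
  exists s : {perm 'I_n}, forall i j, adj H (s i) (s j) = adj G i j.

Definition graph_property n (P : {set graph n}) : Prop :=
  forall G H : graph n, isomorphic G H -> G \in P -> H \in P.

Definition monotone n (P : {set graph n}) : Prop :=
  forall G H : graph n, G \in P -> H \subset G -> H \in P.

Definition trivial n (P : {set graph n}) : Prop := P = set0 \/ P = setT.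

Definition nontrivial n (P : {set graph n}) : Prop := ~ trivial P.

(* Adaptive strategies: [Ask e no yes] asks whether e is an edge and continues
   with [no] or [yes] according to the reply. *)
Inductive strategy (n : nat) : Type :=
| Answer of bool
| Ask of vpair n & strategy n & strategy n.

Arguments Answer {n}.

Fixpoint verdict n (t : strategy n) (G : graph n) : bool :=
  match t with
  | Answer b => b
  | Ask e no yes => if e \in G then verdict yes G else verdict no G
  end.

Fixpoint questions n (t : strategy n) (G : graph n) : nat :=
  match t with
  | Answer _ => 0
  | Ask e no yes => (if e \in G then questions yes G else questions no G).+1
  end.

Definition decided_within n (P : {set graph n}) (k : nat) : Prop :=
  exists t : strategy n,
    forall G : graph n, verdict t G = (G \in P) /\ questions t G <= k.

Fixpoint ask_all n (P : {set graph n}) (s : seq (vpair n)) (K : graph n) :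
    strategy n :=
  if s is e :: s' then Ask e (ask_all P s' K) (ask_all P s' (e |: K))
  else Answer (K \in P).

Lemma verdict_ask_all n (P : {set graph n}) s K G :
  verdict (ask_all P s K) G = (K :|: [set e in s | e \in G] \in P).
Proof.
elim: s K => [|e s IHs] K /=.
  by congr (_ \in P); apply/setP => f; rewrite !inE orbF.
case: ifP => Ge; rewrite IHs; congr (_ \in P); apply/setP => f; rewrite !inE.
  by case: (eqVneq f e) => [->|_] //=; rewrite Ge orbT.
by case: (eqVneq f e) => [->|_] //=; rewrite Ge !andbF.
Qed.

Lemma questions_ask_all n (P : {set graph n}) s K G :
  questions (ask_all P s K) G = size s.
Proof. by elim: s K => [|e s IHs] K //=; case: ifP; rewrite IHs. Qed.

Lemma decided_within_ex n (P : {set graph n}) :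
  exists k, `[< decided_within P k >].
Proof.
exists (size (enum {: vpair n})); apply/asboolP.
exists (ask_all P (enum {: vpair n}) set0) => G.
rewrite verdict_ask_all questions_ask_all set0U; split=> //.
by congr (_ \in P); apply/setP => e; rewrite !inE mem_enum.
Qed.

Definition complexity n (P : {set graph n}) : nat :=
  ex_minn (decided_within_ex P).

Definition evasive n (P : {set graph n}) : Prop := complexity P = 'C(n, 2).

Definition graph_of_rel n (r : rel 'I_n) : graph n :=
  [set e | [exists i, exists j, (val e == [set i; j]) && r i j]].

(* Two cycles of length p >= 3, on the vertices 0, ..., p - 1 and
   p, ..., 2p - 1; consecutive vertices differ by 1 modulo p. *)
Definition two_cycles (p : nat) : graph (2 * p) :=
  graph_of_rel (fun i j : 'I_(2 * p) =>
    ((i < p) == (j < p)) && (j == i.+1 %[mod p])).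

Definition complete_bipartite (p : nat) : graph (2 * p) :=
  graph_of_rel (fun i j : 'I_(2 * p) => (i < p) && (p <= j)).

(* Main.v *)
Require Import Defs.
From mathcomp Require Import all_boot all_fingroup.
From mathcomp Require Import ssralg zmodp boolp.

(* Order the nonempty members of P by inclusion. A strategy asking fewer than
   C(2p, 2) questions shows, by induction on the decision tree, that the order
   complex of this poset is acyclic: a question e splits an interval of P into
   the deletion and the link of e, and the members containing e are added to
   the deletion one at a time, each along an acyclic link. Let the rotations of
   the blocks {0, ..., p - 1} and {p, ..., 2p - 1} generate (Z/p)^2. By Smith
   theory over F_p, applied twice, the poset of invariant members is still
   acyclic; in particular it is nonempty and connected. An invariant graph with
   an edge between the blocks contains K_{p,p}, and one with edges inside both
   blocks contains a copy of 2C_p. If both are excluded from P, every invariant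
   member has its edges inside a single block, so the invariant poset is the
   disjoint union of two pieces exchanged by swapping the blocks: it is empty or
   disconnected, a contradiction. *)

Set Implicit Arguments.
Unset Strict Implicit.
Unset Printing Implicit Defensive.

Import GRing.Theory.

(** * Cochains of the order complex *)

Section Cochains.

Local Open Scope ring_scope.

Variables (T : finType) (r : rel T) (K : comNzRingType).
Hypothesis r_irr : irreflexive r.

Implicit Types (x v : T) (S X : {set T}) (f g : {set T} -> K) (n : nat).

Definition chain S :=
  [forall u in S, forall v in S, (u != v) ==> (r u v (+) r v u)].

Definition cell X n S := [&& S \subset X, chain S & #|S| == n].

Definition sgn v S : K := (-1) ^+ #|[set u in S | r u v]|.

(* On a chain this is the usual simplicial coboundary, the vertices being
   listed in increasing order. *)
Definition coboundary f S := \sum_(v in S) sgn v S * f (S :\ v).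

(* Exactness in every degree of the augmented cochain complex of the order
   complex of [X]; the empty chain has degree 0. *)
Definition acyclic X := forall n f,
  (forall S, cell X n.+1 S -> coboundary f S = 0) ->
  exists g, forall S, cell X n S -> f S = coboundary g S.

(** Interior product with the vertex [x], the sign moving [x] to the front of the chain: the
    contracting homotopy of a cone with apex [x]. *)
Definition contraction x f S := sgn x S * f (x |: S).

Lemma chainP S :
  reflect {in S &, forall u v, u != v -> r u v (+) r v u} (chain S).
Proof.
apply: (iffP forall_inP) => [h u v Su Sv | h u Su].
  by move/forall_inP: (h u Su) => /(_ v Sv)/implyP.
by apply/forall_inP => v Sv; apply/implyP; apply: h.
Qed.

Lemma chain_sub S S' : S' \subset S -> chain S -> chain S'.
Proof.
move=> /subsetP sub /chainP ch; apply/chainP => u v Su Sv.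
by apply: ch; apply: sub.
Qed.

Lemma cell_sub X X' n S : X \subset X' -> cell X n S -> cell X' n S.
Proof.
by move=> sub /and3P[SX ch cS]; rewrite /cell (subset_trans SX sub) ch.
Qed.

Lemma cell_setD1 X n S v : cell X n.+1 S -> v \in S -> cell X n (S :\ v).
Proof.
case/and3P=> SX ch cS Sv; have sub := subsetDl S [set v].
rewrite /cell (subset_trans sub SX) (chain_sub sub ch) /=.
by rewrite (cardsD1 v) Sv in cS.
Qed.

Lemma eq_coboundary f g S :
  (forall v, v \in S -> f (S :\ v) = g (S :\ v)) ->
  coboundary f S = coboundary g S.
Proof. by move=> fg; apply: eq_bigr => v Sv; rewrite fg. Qed.

Lemma coboundaryB f g S :
  coboundary (fun S' => f S' - g S') S = coboundary f S - coboundary g S.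
Proof. by rewrite -sumrB; apply: eq_bigr => v _; rewrite mulrBr. Qed.

Lemma coboundary_sum (I : finType) (c : I -> K) (F : I -> {set T} -> K) S :
  coboundary (fun S' => \sum_i c i * F i S') S =
  \sum_i c i * coboundary (F i) S.
Proof.
under [RHS]eq_bigr do rewrite mulr_sumr.
rewrite [RHS]exchange_big; apply: eq_bigr => v _.
by rewrite mulr_sumr; apply: eq_bigr => i _; rewrite mulrCA.
Qed.

Lemma coboundary0 S : coboundary (fun=> 0) S = 0.
Proof. by apply: big1 => v _; rewrite mulr0. Qed.

Lemma sgn_sqr v S : sgn v S * sgn v S = 1.
Proof. by rewrite -expr2 sqrr_sign. Qed.

Lemma sgnU1 v x S :
  x \notin S -> sgn v (x |: S) = (-1) ^+ r x v * sgn v S.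
Proof.
move=> xS; rewrite /sgn -exprD; congr (_ ^+ _).
have [rxv|rxv] := boolP (r x v).
  have -> : [set u in x |: S | r u v] = x |: [set u in S | r u v].
    by apply/setP => u; rewrite !inE; case: eqVneq => // ->.
  by rewrite cardsU1 inE (negPf xS).
apply: eq_card => u; rewrite !inE.
by case: eqVneq => // ->; rewrite (negPf rxv) !andbF.
Qed.

(** Deleting [x] gives the first term. In the others, adding [x] may flip the sign of [v] and adding
    [v] may flip the sign of [x]; exactly one flip occurs on a chain, whence the minus. *)
Lemma coboundary_cone f x S : x \notin S -> chain (x |: S) ->
  coboundary f (x |: S) = sgn x S * (f S - coboundary (contraction x f) S).
Proof.
move=> xS /chainP ch; rewrite /coboundary big_setU1 //= mulrBr.
rewrite sgnU1 // r_irr mul1r setU1K //; congr (_ + _).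
rewrite mulr_sumr -sumrN; apply: eq_bigr => v Sv.
have xv : v != x by apply: contraNneq xS => <-.
have -> : (x |: S) :\ v = x |: (S :\ v).
  apply/setP => u; rewrite !inE.
  by case: (eqVneq u x) => // ->; rewrite eq_sym xv.
rewrite sgnU1 // -[X in sgn x X](setD1K Sv) sgnU1 ?setD11 // /contraction.
have := ch v x; rewrite !inE Sv eqxx orbT => /(_ isT isT xv).
set s := sgn x _; set t := sgn v S; set F := f _.
have ss : s * s = 1 := sgn_sqr _ _.
have -> (a : K) : a * s * (t * (s * F)) = a * t * F * (s * s).
  by rewrite !mulrA ![_ * s]mulrC !mulrA.
rewrite ss mulr1 -!mulNr.
by case: (r v x); case: (r x v) => //= _; rewrite ?mulN1r ?opprK ?mul1r.
Qed.

(** Induction on the chain. By the cone formula the contraction of [coboundary f] is [f] minus the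
    coboundary of [contraction x f]; the induction hypothesis disposes of the last term. *)
Lemma coboundaryK f S : chain S -> coboundary (coboundary f) S = 0.
Proof.
elim: {S}#|S| {-2}S (erefl #|S|) f => [|n IHn] S cS f ch.
  by apply: big1 => v; rewrite (cards0_eq cS) inE.
have [x Sx] : exists x, x \in S by apply/card_gt0P; rewrite cS.
have xS' : x \notin S :\ x by rewrite setD11.
rewrite -(setD1K Sx) in ch *; rewrite coboundary_cone //.
set S' := S :\ x in ch xS' *.
rewrite [coboundary (contraction _ _) _](@eq_coboundary _
  (fun R => f R - coboundary (contraction x f) R)).
  rewrite coboundaryB IHn ?subr0 ?subrr ?mulr0 //.
    by rewrite (cardsD1 x) Sx in cS; case: cS.
  exact: chain_sub (subsetUr _ _) ch.
move=> v Sv; rewrite {1}/contraction coboundary_cone.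
- by rewrite mulrA sgn_sqr mul1r.
- by rewrite in_setD1 negb_and xS' orbT.
- by apply: chain_sub ch; rewrite setUS // subsetDl.
Qed.

Lemma coboundary_notin f x S : x \notin S ->
  coboundary (fun S' => if x \in S' then f S' else 0) S = 0.
Proof.
by move=> xS; apply: big1 => v Sv; rewrite !inE (negPf xS) andbF mulr0.
Qed.

Lemma cell_setU1 X n x S : x \in X -> S \subset X -> x \notin S ->
  chain S -> #|S| = n -> {in S, forall v, r v x (+) r x v} ->
  cell X n.+1 (x |: S).
Proof.
move=> Xx SX xS ch cS cmp; apply/and3P; split.
- by rewrite subUset sub1set Xx.
- move/chainP: ch => ch; apply/chainP => u v /setU1P[->|Su] /setU1P[->|Sv] //.
  + by rewrite eqxx.
  + by rewrite addbC => _; apply: cmp.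
  + by move=> _; apply: cmp.
  + exact: ch.
- by rewrite cardsU1 xS cS.
Qed.

(** The contraction with the apex [c], set to zero on chains through [c], is a primitive of any
    cocycle. *)
Lemma acyclic_cone X c : c \in X ->
  {in X, forall v, v != c -> r v c (+) r c v} -> acyclic X.
Proof.
move=> Xc cmp n f df.
pose g S := if c \in S then 0 else contraction c f S.
exists g => S cell_S.
have [cS|cS] := boolP (c \in S); last first.
  have cell_cS : cell X n.+1 (c |: S).
    case/and3P: cell_S => SX ch /eqP cardS; apply: cell_setU1 => // v Sv.
    by apply: cmp; [apply: (subsetP SX) | apply: contraNneq cS => <-].
  have := df _ cell_cS; case/and3P: cell_cS => _ ch _.
  rewrite coboundary_cone // => /(congr1 (fun a => sgn c S * a)).
  rewrite mulrA sgn_sqr mul1r mulr0 => /subr0_eq ->.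
  by apply: eq_coboundary => v Sv; rewrite /g !inE (negPf cS) andbF.
rewrite /coboundary (bigD1 c) //= /g setD11 /contraction setD1K // mulrA.
rewrite -[in X in X * _ * _](setD1K cS) sgnU1 ?setD11 // r_irr mul1r sgn_sqr.
rewrite mul1r big1 ?addr0 // => v /andP[_ vc].
by rewrite !inE cS eq_sym vc mulr0.
Qed.

Definition link X x := [set y in X | r y x || r x y].

(** Mayer-Vietoris for [X :\ x] and the cone over the link of [x]. After subtracting a primitive
    found on [X :\ x], the cocycle lives on chains through [x] and becomes a cocycle of the link in
    one degree less. *)
Lemma acyclic_point X x : {in link X x, forall y, r y x (+) r x y} ->
  acyclic (X :\ x) -> acyclic (link X x) -> acyclic X.
Proof.
move=> asym acD acL n f df.
have [Xx|xX] := boolP (x \in X); last first.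
  suff <- : X :\ x = X by apply: acD => S /(cell_sub (subsetDl _ _))/df.
  by apply/setP => u; rewrite !inE; case: eqVneq => // ->; rewrite (negPf xX).
have linkE S : S \subset X -> chain S -> x \in S -> S :\ x \subset link X x.
  move=> SX /chainP ch Sx; apply/subsetP => v /setD1P[vx Sv].
  rewrite inE (subsetP SX) //=.
  by have := ch v x Sv Sx vx; case: (r v x); case: (r x v).
have cellD m S : x \notin S -> cell X m S -> cell (X :\ x) m S.
  by move=> xS; rewrite /cell subsetD1 xS andbT.
have [g gE] := acD n f (fun S => df S \o cell_sub (subsetDl _ _)).
pose f' S := f S - coboundary g S.
have f'0 S : x \notin S -> cell X n S -> f' S = 0.
  by move=> xS /(cellD _ _ xS)/gE fE; rewrite /f' fE subrr.
have df' S : cell X n.+1 S -> coboundary f' S = 0.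
  by move=> cS; rewrite coboundaryB df // coboundaryK ?subrr //; case/and3P: cS.
suff [m mE] : exists m, forall S, cell X n S -> f' S = coboundary m S.
  exists (fun S => g S + m S) => S cS.
  have := mE S cS; rewrite /f' => /eqP; rewrite subr_eq => /eqP ->.
  rewrite /coboundary addrC -big_split; apply: eq_bigr => v _.
  by rewrite mulrDr.
(* In degree 0 the only chain is empty and avoids [x], so [f'] vanishes. *)
case: n => [|n] in df f'0 df' gE *.
  exists (fun=> 0) => S cS; rewrite coboundary0 f'0 //.
  by case/and3P: cS => _ _; rewrite cards_eq0 => /eqP->; rewrite inE.
have linkU S k : cell (link X x) k S -> x \notin S /\ cell X k.+1 (x |: S).
  case/and3P=> SL ch /eqP cS.
  have xS : x \notin S.
    by apply/negP => /(subsetP SL); rewrite inE r_irr andbF.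
  split=> //; apply: cell_setU1 => //.
    by apply: subset_trans SL _; apply/subsetP => v; rewrite inE => /andP[].
  by move=> v /(subsetP SL)/asym.
have [m mE] : exists m, forall S, cell (link X x) n S ->
    contraction x f' S = coboundary m S.
  apply: acL => S cS; have [xS cxS] := linkU _ _ cS.
  have ch : chain (x |: S) by case/and3P: cxS.
  have := df' _ cxS; rewrite coboundary_cone // f'0 //.
    rewrite sub0r => /(congr1 (fun a => sgn x S * a)).
    by rewrite mulrA sgn_sqr mul1r mulr0 => /eqP; rewrite oppr_eq0 => /eqP.
  rewrite /cell (chain_sub (subsetUr _ _) ch).
  rewrite (subset_trans (subsetUr [set x] S)).
    by case/and3P: cS.
  by case/and3P: cxS.
(* The minus sign cancels the one in the cone formula. *)
exists (fun S => if x \in S then - (sgn x (S :\ x) * m (S :\ x)) else 0).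
move=> S cS; have [xS|xS] := boolP (x \in S); last first.
  rewrite f'0 //.
  by rewrite (coboundary_notin (fun S => - (sgn x (S :\ x) * m (S :\ x)))).
have := cS; case/and3P => SX ch _.
have cSx : cell (link X x) n (S :\ x).
  have := cell_setD1 cS xS; case/and3P => _ ch' card'.
  by rewrite /cell linkE // ch'.
have fE := mE _ cSx; rewrite /contraction setD1K // in fE.
rewrite -[in RHS](setD1K xS) coboundary_cone ?setD11 ?setD1K ?setD11 //.
rewrite sub0r -[LHS]mul1r -(sgn_sqr x (S :\ x)) -mulrA fE.
congr (_ * _); rewrite -sumrN; apply: eq_bigr => v Sv.
rewrite -mulrN; congr (_ * _).
rewrite /contraction setU11 setU1K ?mulrN ?opprK ?mulrA ?sgn_sqr ?mul1r //.
by rewrite !inE eqxx andbF.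
Qed.

End Cochains.

(** * Nonemptiness and connectedness from exactness in degrees 0 and 1 *)

Section Connected.

Local Open Scope ring_scope.

Variables (T : finType) (r : rel T) (K : comNzRingType) (X : {set T}).
Hypotheses (r_irr : irreflexive r) (acX : acyclic r K X).

(** On an empty poset the constant 1 in degree 0 is a cocycle, while every coboundary at the empty
    chain is an empty sum. *)
Lemma acyclic_neq0 : X != set0.
Proof.
apply/eqP => X0; have [|g gE] := acX (n := 0%N) (f := fun=> 1).
  by move=> S /and3P[]; rewrite X0 subset0 => /eqP-> _; rewrite cards0.
have c0 : cell r X 0 set0.
  rewrite /cell sub0set cards0 eqxx andbT.
  by apply/chainP => u v; rewrite inE.
by have /eqP := gE _ c0; rewrite /coboundary big_set0 oner_eq0.
Qed.

(** Such a [phi] is a cocycle in degree 1; its primitive is a single value at the empty chain, which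
    every [phi x] must equal. *)
Lemma acyclic_connected (phi : T -> K) :
  {in X &, forall x y, r x y -> phi x = phi y} ->
  {in X &, forall x y, phi x = phi y}.
Proof.
move=> phiE.
have sgn0 x : sgn r K x set0 = 1.
  rewrite /sgn (_ : [set u in _ | _] = set0) ?cards0 //.
  by apply/setP => u; rewrite !inE.
have sgn1 x : sgn r K x [set x] = 1.
  by rewrite -[X in sgn _ _ _ X]setU0 sgnU1 ?inE // r_irr mul1r.
have [S /and3P[SX /chainP ch /cards2P[x [y [xy SE]]]]|g gE] :=
    acX (n := 1%N) (f := fun S => \sum_(x in S) phi x).
  have [xX yX] : x \in X /\ y \in X.
    by split; apply: (subsetP SX); rewrite SE !inE eqxx ?orbT.
  have chxy : r x y || r y x.
    have := ch x y; rewrite SE !inE !eqxx orbT => /(_ isT isT xy).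
    by case: (r x y); case: (r y x).
  have cx : chain r (x |: [set y]) by apply/chainP; rewrite -SE.
  have xy' : x \notin [set y] by rewrite inE.
  rewrite SE (coboundary_cone r_irr _ xy' cx) /coboundary /contraction.
  rewrite !big_set1 setDv setU0 !big_set1 sgn0 sgn1 !mul1r.
  have -> : phi x = phi y by case/orP: chxy => /phiE ->.
  by rewrite subrr mulr0.
suff phig x : x \in X -> phi x = g set0.
  by move=> x y Xx Xy; rewrite !phig.
move=> Xx; have := gE [set x]; rewrite /coboundary !big_set1 sgn1 setDv mul1r.
apply; rewrite /cell sub1set Xx cards1 eqxx andbT.
by apply/chainP => u v /set1P-> /set1P->; rewrite eqxx.
Qed.

End Connected.

(** * Smith theory *)

Section Smith.

Local Open Scope ring_scope.

Variables (T : finType) (r : rel T) (K : comNzRingType) (p : nat).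
Hypotheses (r_irr : irreflexive r) (p_pr : prime p) (pK : p%:R = 0 :> K).

Variables (g : T -> T) (X : {set T}).
Hypotheses (g_inj : injective g) (g_mono : {mono g : x y / r x y}).
Hypotheses (g_iter : forall x, iter p g x = x) (gX : {homo g : x / x \in X}).
Hypothesis (g_incomp : forall x, r x (g x) = false /\ r (g x) x = false).

Implicit Types (x v : T) (S : {set T}) (f w : {set T} -> K) (n : nat).
Implicit Types c : 'I_p -> K.

Local Notation delta := (@coboundary T r K).
Local Notation gam := (fun S : {set T} => g @: S).
Local Notation fixX := [set x in X | g x == x].

Let gam_inj : injective gam.
Proof. exact: imset_inj. Qed.

Lemma iter_imsetE i S : iter i gam S = iter i g @: S.
Proof.
elim: i => [|i IHi] /=; first by rewrite imset_id.
by rewrite IHi -imset_comp.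
Qed.

Lemma iter_imset_id S : iter p gam S = S.
Proof.
by rewrite iter_imsetE -[RHS]imset_id; apply: eq_imset => x; rewrite g_iter.
Qed.

Lemma imset_setD1 S v : g @: (S :\ v) = g @: S :\ g v.
Proof.
apply/setP => y; rewrite in_setD1.
apply/imsetP/andP => [[x /setD1P[xv Sx] ->]|].
  by rewrite (inj_eq g_inj) imset_f.
case=> ygv /imsetP[x Sx yE]; exists x => //.
by rewrite !inE Sx -(inj_eq g_inj) -yE ygv.
Qed.

Lemma sgn_imset v S : sgn r K (g v) (g @: S) = sgn r K v S.
Proof.
rewrite /sgn -(card_imset [set u in S | r u v] g_inj); congr (_ ^+ _).
apply: eq_card => y; rewrite inE.
apply/andP/imsetP => [[/imsetP[x Sx ->]]|[x]].
  by rewrite g_mono => rxv; exists x; rewrite ?inE ?Sx.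
by rewrite inE => /andP[Sx rxv] ->; rewrite g_mono imset_f.
Qed.

Lemma coboundary_shift f S : delta (fun S' => f (g @: S')) S = delta f (g @: S).
Proof.
rewrite /coboundary [RHS](big_imset (h := g)) /=; last exact: in2W.
by apply: eq_bigr => v _; rewrite sgn_imset imset_setD1.
Qed.

Lemma coboundary_iter i f S :
  delta (fun S' => f (iter i gam S')) S = delta f (iter i gam S).
Proof.
elim: i f => [|i IHi] f //=.
by rewrite (IHi (fun S' => f (g @: S'))) coboundary_shift.
Qed.

Lemma cell_imset n S : cell r X n S -> cell r X n (g @: S).
Proof.
case/and3P=> /subsetP SX /chainP ch cS; apply/and3P; split.
- by apply/subsetP => _ /imsetP[x Sx ->]; apply/gX/SX.
- apply/chainP => _ _ /imsetP[x Sx ->] /imsetP[y Sy ->].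
  by rewrite (inj_eq g_inj) !g_mono; apply: ch.
- by rewrite card_imset.
Qed.

Lemma cell_iter n S i : cell r X n S -> cell r X n (iter i gam S).
Proof. by move=> cS; elim: i => //= i; apply: cell_imset. Qed.

(** As [x] and [g x] are never related, a chain mapped onto itself is fixed vertex by vertex. Thus
    the invariant chains form the order complex of the fixed points. *)
Lemma fixed_chainP n S :
  cell r X n S -> reflect (g @: S = S) (S \subset fixX).
Proof.
case/and3P=> SX /chainP ch _; apply: (iffP subsetP) => [fS | gS x Sx].
  rewrite -[RHS]imset_id; apply: eq_in_imset => x /fS.
  by rewrite inE => /andP[_ /eqP].
rewrite inE (subsetP SX) //=; have Sgx : g x \in S by rewrite -gS imset_f.
have [//|/(ch _ _ Sgx Sx)] := eqVneq.
by have [-> ->] := g_incomp x.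
Qed.

Lemma cell_fixX n S : cell r fixX n S <-> cell r X n S /\ g @: S = S.
Proof.
split=> [cS|[cS gS]]; last first.
  rewrite /cell (introT (fixed_chainP cS) gS).
  by case/and3P: cS => _ -> ->.
have cX : cell r X n S.
  by apply: cell_sub cS; apply/subsetP => x; rewrite inE => /andP[].
by split=> //; apply/(fixed_chainP cX); case/and3P: cS.
Qed.

(* Action of the group ring element [\sum_i c_i g^i]. *)
Definition orbit_op c f S := \sum_i c i * f (iter i gam S).

Lemma coboundary_op c f S : delta (orbit_op c f) S = orbit_op c (delta f) S.
Proof.
rewrite (coboundary_sum r c (fun i : 'I_p => fun S' => f (iter i gam S'))).
by apply: eq_bigr => i _; rewrite coboundary_iter.
Qed.

Lemma eq_orbit_op c f w S :
  (forall i, f (iter i gam S) = w (iter i gam S)) ->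
  orbit_op c f S = orbit_op c w S.
Proof. by move=> fw; apply: eq_bigr => i _; rewrite fw. Qed.

Lemma orbit_opB c f w S :
  orbit_op c (fun S' => f S' - w S') S = orbit_op c f S - orbit_op c w S.
Proof. by rewrite -sumrB; apply: eq_bigr => i _; rewrite mulrBr. Qed.

Lemma orbit_op_fixed c f S :
  \sum_i c i = 0 -> g @: S = S -> orbit_op c f S = 0.
Proof.
move=> c0 gS; rewrite /orbit_op; under eq_bigr do rewrite iter_fix //.
by rewrite -mulr_suml c0 mul0r.
Qed.

(** The two Smith elements of the group ring, [1 + g + ... + g^(p-1)] and [1 - g]; each annihilates
    the other. *)
Definition norm_coef (i : 'I_p) : K := 1.
Definition diff_coef (i : 'I_p) : K := (i == 0 :> nat)%:R - (i == 1 :> nat)%:R.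

Lemma sum_delta (F : nat -> K) k :
  (k < p)%N -> \sum_(i < p) (i == k :> nat)%:R * F i = F k.
Proof.
move=> kp; rewrite (bigD1 (Ordinal kp)) //= eqxx mul1r big1 ?addr0 // => i.
by rewrite -val_eqE /= => /negPf ->; rewrite mul0r.
Qed.

Lemma diffE f S : orbit_op diff_coef f S = f S - f (g @: S).
Proof.
rewrite /orbit_op; under eq_bigr do rewrite mulrBl.
rewrite sumrB !(sum_delta (fun i => f (iter i gam S))) //.
  exact: prime_gt1.
exact: prime_gt0.
Qed.

Lemma normE f S : orbit_op norm_coef f S = \sum_(i < p) f (iter i gam S).
Proof. by apply: eq_bigr => i _; rewrite mul1r. Qed.

Lemma sum_shift (F : nat -> K) :
  F p = F 0%N -> \sum_(i < p) F i.+1 = \sum_(i < p) F i.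
Proof.
move=> Fp; apply: (addrI (F 0%N)); rewrite -(big_ord_recl p (fun i => F i)).
by rewrite big_ord_recr /= Fp addrC.
Qed.

(** Characteristic [p] enters here: through [orbit_op_fixed] it makes the norm vanish on invariant
    chains. *)
Lemma sum_norm_coef : \sum_i norm_coef i = 0.
Proof. by rewrite sumr_const card_ord. Qed.

Lemma sum_diff_coef : \sum_i diff_coef i = 0.
Proof.
have := diffE (fun=> 1) set0; rewrite subrr => {2}<-.
by apply: eq_bigr => i _; rewrite mulr1.
Qed.

Lemma diff_norm f S : orbit_op diff_coef (orbit_op norm_coef f) S = 0.
Proof.
rewrite diffE !normE -(sum_shift (F := fun i => f (iter i gam S))).
  by apply/eqP; rewrite subr_eq0; apply/eqP/eq_bigr => i _; rewrite -iterSr.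
by rewrite iter_imset_id.
Qed.

Lemma norm_diff f S : orbit_op norm_coef (orbit_op diff_coef f) S = 0.
Proof.
rewrite normE; under eq_bigr do rewrite diffE.
rewrite sumrB; apply/eqP; rewrite subr_eq0; apply/eqP/esym.
by apply: (sum_shift (F := fun i => f (iter i gam S))); rewrite iter_imset_id.
Qed.

Lemma order_imset S : g @: S != S -> fingraph.order gam S = p.
Proof.
move=> gS; set o := fingraph.order gam S.
have o_gt0 : (0 < o)%N by apply: fingraph.order_gt0.
have oS : iter o gam S = S by apply: iter_order.
have pmo : p %% o = 0%N.
  rewrite -(findex_iter (ltn_pmod p o_gt0)).
  suff -> : iter (p %% o) gam S = iter 0 gam S by rewrite findex_iter.
  have := iter_imset_id S; rewrite {1}(divn_eq p o) addnC iterD iterM.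
  by rewrite (iter_fix _ oS).
have : (o %| p)%N by rewrite /dvdn pmo.
case/primeP: p_pr => _ /[apply] /orP[/eqP o1|/eqP //].
by rewrite o1 /= in oS; rewrite oS eqxx in gS.
Qed.

(** Indicator of one chosen element in each orbit of size greater than 1. *)
Definition orbit_rep S : K := ((froot gam S == S) && (g @: S != S))%:R.

Lemma sum_orbit_rep S :
  \sum_(i < p) orbit_rep (iter i gam S) = (g @: S != S)%:R.
Proof.
have [gS|gS] := eqVneq (g @: S) S.
  by rewrite big1 // => i _; rewrite iter_fix // /orbit_rep gS eqxx andbF.
pose R := froot gam S.
have kp : (findex gam S R < p)%N.
  by rewrite -(order_imset gS) findex_max // connect_root.
have repE i : orbit_rep (iter i gam S) = (R == iter i gam S)%:R.
  have -> : R = froot gam (iter i gam S).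
    apply/eqP; rewrite /R (root_connect (fconnect_sym gam_inj)).
    exact: fconnect_iter.
  rewrite /orbit_rep.
  suff -> : g @: iter i gam S != iter i gam S by rewrite andbT.
  by elim: i => //= i; rewrite (inj_eq (imset_inj g_inj)).
rewrite (bigD1 (Ordinal kp)) //= repE iter_findex ?connect_root // eqxx.
rewrite big1 ?addr0 // => i; rewrite -val_eqE /= => /eqP ik.
rewrite repE; case: eqP => // RE; case: ik.
by rewrite RE findex_iter // order_imset.
Qed.

(** Cochains vanishing on invariant chains form a free module over the group ring, where the kernel
    of one Smith element is the image of the other. *)
Definition stable_kernel c c' := forall n w,
  (forall S, cell r X n S -> orbit_op c w S = 0) ->
  (forall S, cell r fixX n S -> w S = 0) ->
  exists u, forall S, cell r X n S -> w S = orbit_op c' u S.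

(** A cochain killed by [1 - g] is constant on orbits, hence the norm of its restriction to orbit
    representatives. *)
Lemma diff_kernel : stable_kernel diff_coef norm_coef.
Proof.
move=> n w dw w0; exists (fun S => orbit_rep S * w S) => S cS.
have wi i : w (iter i gam S) = w S.
  elim: i => //= i <-; apply/esym/eqP; rewrite -subr_eq0 -diffE.
  by rewrite dw // cell_iter.
rewrite normE; under eq_bigr do rewrite wi.
rewrite -mulr_suml sum_orbit_rep; case: eqP => [gS|_]; last by rewrite mul1r.
by rewrite mul0r w0 //; apply/cell_fixX.
Qed.

(* With [e] the indicator of orbit representatives, [w = \sum_i g^i w_i] where
   [w_i = e * (g^-i w)]; as [\sum_i w_i = e * norm w = 0] this equals
   [\sum_i (g^i - 1) w_i], a multiple of [1 - g]. *)
Lemma norm_kernel : stable_kernel norm_coef diff_coef.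
Proof.
move=> n w nw w0.
pose wi i S := orbit_rep S * w (iter (p - i) gam S).
(* The geometric sum [(1 + g + ... + g^(i-1)) w_i], which [1 - g] telescopes to [w_i - g^i w_i]. *)
pose part i S := \sum_(j < i) wi i (iter j gam S).
exists (fun S => - \sum_(i < p) part i S) => S cS.
have partE i : part i S - part i (g @: S) = wi i S - wi i (iter i gam S).
  rewrite /part; elim: i (wi i) => [|i IHi] F.
    by rewrite !big_ord0 !subrr.
  by rewrite !big_ord_recr /= opprD addrACA IHi -iterSr addrA subrK.
rewrite diffE -opprD -sumrB; under eq_bigr do rewrite partE.
rewrite sumrB.
have -> : \sum_(i < p) wi i S = 0.
  rewrite -mulr_sumr (reindex_inj rev_ord_inj) /=.
  have -> : \sum_(i < p) w (iter (p - (p - i.+1)) gam S) =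
      orbit_op norm_coef w S.
    rewrite normE -(sum_shift (F := fun i => w (iter i gam S))).
      by apply: eq_bigr => i _; rewrite subKn.
    by rewrite iter_imset_id.
  by rewrite nw ?mulr0.
rewrite sub0r opprK.
have -> : \sum_(i < p) wi i (iter i gam S) =
    \sum_(i < p) orbit_rep (iter i gam S) * w S.
  apply: eq_bigr => i _; rewrite /wi -iterD subnK ?iter_imset_id //.
  exact: ltnW.
rewrite -mulr_suml sum_orbit_rep; case: eqP => [gS|_]; last by rewrite mul1r.
by rewrite mul0r w0 //; apply/cell_fixX.
Qed.

Hypothesis acX : acyclic r K X.

(** Exactness of the subcomplex of multiples of [c]: the primitive must again be such a multiple. *)
Definition exact_op c n := forall a,
  (forall S, cell r X n.+1 S -> delta (orbit_op c a) S = 0) ->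
  exists z, forall S, cell r X n S -> orbit_op c a S = delta (orbit_op c z) S.

(* The diagram chase in the long exact sequence of
   [0 -> c' C -> C -> c C (+) C(fixX) -> 0]. *)
Lemma exact_op_step c c' n :
  \sum_i c i = 0 -> \sum_i c' i = 0 ->
  (forall f S, orbit_op c (orbit_op c' f) S = 0) ->
  stable_kernel c c' -> exact_op c' n.+1 -> forall a b,
  (forall S, cell r X n.+1 S -> delta (orbit_op c a) S = 0) ->
  (forall S, cell r fixX n.+1 S -> delta b S = 0) ->
  exists z,
    (forall S, cell r X n S -> orbit_op c a S = delta (orbit_op c z) S) /\
    (forall S, cell r fixX n S -> b S = delta z S).
Proof.
move=> sum_c sum_c' cc' ker_c exact_c' a b da db.
(* A lift of the pair [a], [b]: since [c] vanishes on invariant chains, [c] does not distinguish [w]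
   from [a]. *)
pose w S := if g @: S == S then b S else a S.
have cw S : orbit_op c w S = orbit_op c a S.
  have [gS|gS] := eqVneq (g @: S) S; first by rewrite !orbit_op_fixed.
  apply: eq_orbit_op => i; rewrite /w; case: eqP => // giS; case/eqP: gS.
  by elim: i giS => //= i IHi /(imset_inj g_inj).
have [u uE] : exists u, forall S, cell r X n.+1 S ->
    delta w S = orbit_op c' u S.
  apply: ker_c => S cS.
    rewrite -coboundary_op -[RHS](da S cS).
    by apply: eq_coboundary => v _; apply: cw.
  rewrite -[RHS](db S cS); apply: eq_coboundary => v Sv.
  by have /cell_fixX[_ gS] := cell_setD1 cS Sv; rewrite /w gS eqxx.
(* The multiple of [c'] just found is a coboundary, hence a cocycle; exactness for [c'] one degree
   higher corrects [w] to a cocycle of [X]. *)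
have [u' u'E] : exists u', forall S, cell r X n.+1 S ->
    orbit_op c' u S = delta (orbit_op c' u') S.
  apply: exact_c' => S cS.
  rewrite -[RHS](coboundaryK r_irr w (S := S)); last by case/and3P: cS.
  by apply: eq_coboundary => v Sv; rewrite uE //; apply: cell_setD1 Sv.
have [z zE] : exists z, forall S, cell r X n S ->
    w S - orbit_op c' u' S = delta z S.
  by apply: acX => S cS; rewrite coboundaryB uE // u'E // subrr.
exists z; split=> S cS.
  rewrite coboundary_op -cw.
  have <- : orbit_op c (fun S' => w S' - orbit_op c' u' S') S =
      orbit_op c (delta z) S.
    by apply: eq_orbit_op => i; apply: zE; apply: cell_iter.
  by rewrite orbit_opB cc' subr0.
have /cell_fixX[cX gS] := cS.
by rewrite -zE // /w gS eqxx orbit_op_fixed // subr0.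
Qed.

(** Descending induction on the degree: beyond [#|T|] there are no chains, and exactness for each
    operator in degree [n] follows from that for the other in degree [n.+1]. *)
Lemma exact_ops n : exact_op diff_coef n /\ exact_op norm_coef n.
Proof.
have [m] := ubnP (#|T|.+1 - n).
elim: m n => // m IHm n; rewrite ltnS => nm.
have [nT|nT] := ltnP #|T| n.
  have no S : ~~ cell r X n S.
    apply: contraTN nT => /and3P[_ _ /eqP <-].
    by rewrite -leqNgt max_card.
  by split=> a _; exists a => S cS; case/negP: (no S).
have [] := IHm n.+1; first by rewrite (leq_trans _ nm) // subSS ltn_sub2r.
move=> exD exN; split=> a da.
- have [|z [zE _]] := exact_op_step sum_diff_coef sum_norm_coef diff_norm
    diff_kernel exN (b := fun=> 0) da.
    by move=> S _; rewrite coboundary0.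
  by exists z.
- have [|z [zE _]] := exact_op_step sum_norm_coef sum_diff_coef norm_diff
    norm_kernel exD (b := fun=> 0) da.
    by move=> S _; rewrite coboundary0.
  by exists z.
Qed.

(** Taking [a = 0] in the chase leaves only the component on invariant chains. *)
Theorem acyclic_fixed : acyclic r K fixX.
Proof.
move=> n b db; have [_ exN] := exact_ops n.+1.
have [|z [_ zE]] := exact_op_step sum_diff_coef sum_norm_coef diff_norm
    diff_kernel exN (a := fun=> 0) _ db; last by exists z.
by move=> S _; rewrite coboundary_op diffE !coboundary0 subrr.
Qed.

End Smith.

(** * Decision trees *)

Section NonEvasive.

Variables (n : nat) (K : comNzRingType) (P : {set graph n}).
Hypothesis P_mono : monotone P.

Implicit Types (A B H : graph n) (U X : {set graph n}) (t : strategy n).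

Definition proper_rel : rel (graph n) := fun G H => G \proper H.

Local Notation acyc := (acyclic proper_rel K).

(** [A] collects edges known to be present, the complement of [B] those known to be absent. For
    monotone [P] containing [A] this is the poset of nonempty faces of the link of [A] restricted to
    [B]. *)
Definition interval A B := [set H in P | (A \proper H) && (H \subset B)].

Lemma proper_rel_irr : irreflexive proper_rel.
Proof. by move=> G; rewrite /proper_rel properxx. Qed.

Lemma proper_rel_asym G H :
  proper_rel G H || proper_rel H G -> proper_rel G H (+) proper_rel H G.
Proof.
rewrite /proper_rel !properE; case: (G \subset H); case: (H \subset G) => //.
Qed.

Lemma acyclic_add X H :
  acyc (X :\ H) -> acyc (link proper_rel X H) -> acyc X.
Proof.
apply: acyclic_point; first exact: proper_rel_irr.
by move=> G; rewrite inE => /andP[_ /proper_rel_asym].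
Qed.

Lemma acyclic_comparable X H : H \in X ->
  (forall G, G \in X -> G != H -> (G \proper H) || (H \proper G)) -> acyc X.
Proof.
move=> XH cmp; apply: (acyclic_cone proper_rel_irr XH) => G XG GH.
exact/proper_rel_asym/cmp.
Qed.

(* Elements [H] of [U] are removed in order of increasing size; [H :\ e] is
   then comparable to everything comparable to [H]. *)
Lemma acyclic_add_upper A B e U :
  e \in B :\: A -> U \subset interval (e |: A) B ->
  (forall H H', H \in U -> H' \in interval (e |: A) B -> H \subset H' ->
    H' \in U) ->
  acyc (interval A (B :\ e)) -> acyc (interval A (B :\ e) :|: U).
Proof.
move=> eBA; have [m] := ubnP #|U|; elim: m U => // m IHm U; rewrite ltnS => Um.
move=> UI Uup acD; have [->|[H0 UH0]] := set_0Vmem U; first by rewrite setU0.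
have /setDP[eB eA] := eBA.
have [H UH Hmin] : exists2 H, H \in U & forall G, G \in U -> #|H| <= #|G|.
  by case: (arg_minnP (fun H : graph n => #|H|) UH0) => H UH Hmin; exists H.
have : H \in interval (e |: A) B by apply: (subsetP UI).
rewrite inE => /and3P[PH AH HB].
have eH : e \in H by apply: (subsetP (proper_sub AH)); rewrite setU11.
have notD H' : e \in H' -> H' \notin interval A (B :\ e).
  move=> eH'; rewrite inE subsetD1 eH' !andbF //.
apply: (acyclic_add (H := H)).
  have -> : (interval A (B :\ e) :|: U) :\ H = interval A (B :\ e) :|: (U :\ H).
    apply/setP => G; rewrite !in_setD1 !in_setU in_setD1.
    by case: eqVneq => //= ->; rewrite (negPf (notD _ eH)).
  apply: IHm => //.
  - by rewrite (cardsD1 H) UH in Um.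
  - exact: subset_trans (subsetDl _ _) UI.
  - move=> G G' /setD1P[GH UG] IG' GG'; rewrite in_setD1 (Uup _ _ UG) // andbT.
    apply: contraNneq GH => G'H; rewrite eqEcard Hmin // andbT.
    by rewrite -G'H.
have subAHe : A \proper H :\ e.
  rewrite properE subsetD1 eA.
  rewrite (subset_trans (subsetUr [set e] A) (proper_sub AH)) /=.
  apply: contraTN AH => HeA; rewrite properE negb_and negbK; apply/orP; right.
  by rewrite -(setD1K eH) setUS.
apply: (acyclic_comparable (H := H :\ e)) => [|G].
  rewrite inE in_setU inE subAHe (P_mono PH (subsetDl _ _)) /= setSD //=.
  by rewrite /proper_rel properD1.
rewrite inE in_setU => /andP[mem_G GH] GHe.
case/orP: mem_G => [|UG].
  rewrite inE subsetD1 => /and4P[PG AG GB eG].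
  have GsubH : G \subset H.
    case/orP: GH => /proper_sub // HG.
    by rewrite (subsetP HG) in eG.
  by rewrite properEneq GHe subsetD1 GsubH eG.
(* Minimality of [H] rules out [G] below [H]. *)
case/orP: GH => [GH|HG].
  by have := Hmin G UG; rewrite leqNgt proper_card.
by rewrite (sub_proper_trans (subsetDl _ _) HG) orbT.
Qed.

(** The link of the point [e |: A] is the interval above it; without this point there remain the
    deletion and the larger members containing [e]. If [e |: A] is not in [P], monotonicity keeps
    [e] out of every member of the interval. *)
Lemma acyclic_interval_step A B e :
  e \in B :\: A -> acyc (interval A (B :\ e)) ->
  (e |: A \in P -> acyc (interval (e |: A) B)) -> acyc (interval A B).
Proof.
move=> eBA acD acL; have /setDP[eB eA] := eBA.
have AeA : A \proper e |: A.
  by rewrite properE subsetUr subUset sub1set negb_and eA.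
have [PeA|PeA] := boolP (e |: A \in P); last first.
  suff -> : interval A B = interval A (B :\ e) by [].
  apply/setP => H; rewrite !inE subsetD1.
  have [/= PH|//] := boolP (H \in P); case: (boolP (A \proper H)) => //= AH.
  suff -> : e \notin H by rewrite andbT.
  apply: contraNN PeA => eH; apply: P_mono PH _.
  by rewrite subUset sub1set eH proper_sub.
apply: (acyclic_add (H := e |: A)).
  suff -> : interval A B :\ (e |: A) =
      interval A (B :\ e) :|: interval (e |: A) B.
    by apply: acyclic_add_upper.
  apply/setP => H; rewrite in_setD1 in_setU !inE subsetD1.
  case: (H \in P); rewrite ?andbF //=.
  case: (H \subset B); rewrite ?andbF //= !andbT.
  rewrite [e |: A \proper H]properEneq subUset sub1set [e |: A == H]eq_sym.
  have [eH|eH] := boolP (e \in H); rewrite ?andbF ?andbT ?orbF /=.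
    by rewrite properEneq; have -> : A != H by apply: contraNneq eA => ->.
  by apply: andb_idl => _; apply: contraNneq eH => ->; rewrite setU11.
suff -> : link proper_rel (interval A B) (e |: A) = interval (e |: A) B.
  exact: acL.
apply/setP => H; rewrite !inE /proper_rel.
have [AH|AH] := boolP (e |: A \proper H).
  by rewrite (proper_trans AeA AH) orbT andbT.
rewrite orbF !andbF /=; apply/negP => /andP[/and3P[_ /proper_card AH' _]].
move=> /proper_card; rewrite cardsU1 eA add1n ltnS leqNgt.
by rewrite AH'.
Qed.

(** Induction on the tree. At a leaf the constant verdict puts [B] in [P] along with [A], and the
    strict bound makes [B] differ from [A]; so [B] is the top of the interval, which is a cone. *)
Lemma acyclic_interval t A B : A \subset B ->
  (forall H, A \subset H -> H \subset B ->
    verdict t H = (H \in P) /\ questions t H < #|B :\: A|) ->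
  A \in P -> acyc (interval A B).
Proof.
elim: t A B => [b|e no IHno yes IHyes] A B AB ht PA.
  have [/= bE B_A] := ht A (subxx _) AB.
  have PB : B \in P by have [/= <- _] := ht B AB (subxx _); rewrite bE.
  apply: (acyclic_comparable (H := B)) => [|H].
    rewrite inE PB subxx andbT /= properE AB.
    by rewrite -setD_eq0 -cards_eq0 -lt0n.
  rewrite inE => /and3P[_ _ HB] HneB.
  by rewrite properEneq HneB HB.
(* A question whose answer is already known leaves the interval unchanged. *)
have [eA|eA] := boolP (e \in A).
  apply: IHyes => // H AH HB; have [] := ht H AH HB.
  by rewrite /= (subsetP AH) // => -> /ltnW.
have [eB|eB] := boolP (e \in B); last first.
  apply: IHno => // H AH HB; have [] := ht H AH HB.
  by rewrite /= (negPf (contraNN (subsetP HB e) eB)) => -> /ltnW.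
have eBA : e \in B :\: A by rewrite inE eA.
have cardBA : #|B :\: A| = #|(B :\: A) :\ e|.+1 by rewrite (cardsD1 e) eBA.
apply: (acyclic_interval_step eBA) => [|PeA].
  apply: IHno => // [|H AH]; first by rewrite subsetD1 AB.
  rewrite subsetD1 => /andP[HB eH]; have [] := ht H AH HB.
  rewrite /= (negPf eH) cardBA ltnS => -> qH; split=> //.
  suff -> : B :\ e :\: A = (B :\: A) :\ e by [].
  by rewrite setDDl setUC -setDDl.
apply: IHyes => // [|H]; first by rewrite subUset sub1set eB.
rewrite subUset sub1set => /andP[eH AH] HB; have [] := ht H AH HB.
rewrite /= eH cardBA ltnS => -> qH; split=> //.
suff -> : B :\: (e |: A) = (B :\: A) :\ e by [].
by rewrite setUC -setDDl.
Qed.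

Lemma card_vpair : #|{: vpair n}| = 'C(n, 2).
Proof.
rewrite card_sig -[in RHS](card_ord n) -card_draws.
by apply: eq_card => e; rewrite !inE.
Qed.

Lemma nonevasive_acyclic : ~ evasive P -> P != set0 -> acyc (P :\ set0).
Proof.
move=> ne /set0Pn[G0 PG0].
(* Asking every pair bounds the complexity by the number of pairs; non-evasiveness makes this bound
   strict. *)
have [k [t ht] kn] : exists2 k, decided_within P k & k < #|{: vpair n}|.
  have dec : `[< decided_within P #|{: vpair n}| >].
    apply/asboolP; exists (ask_all P (enum {: vpair n}) set0) => G.
    rewrite verdict_ask_all questions_ask_all set0U cardT; split=> //.
    by congr (_ \in P); apply/setP => e; rewrite !inE mem_enum.
  move: ne; rewrite /evasive /complexity card_vpair in dec *.
  case: ex_minnP => k /asboolP deck /(_ _ dec) kle ne; exists k => //.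
  by rewrite ltn_neqAle kle andbT; apply/eqP.
have -> : P :\ set0 = interval set0 setT.
  by apply/setP => H; rewrite !inE subsetT andbT proper0 andbC.
apply: (acyclic_interval (t := t)) => [|H _ _|]; first exact: sub0set.
  have [-> qH] := ht H; split=> //.
  by rewrite setD0 cardsT (leq_ltn_trans qH).
exact: P_mono PG0 (sub0set _).
Qed.

End NonEvasive.

(** * Permutations of the vertices *)

Section GraphAction.

Variable n : nat.
Implicit Types (G H : graph n) (s t : {perm 'I_n}) (e : vpair n).

Lemma vpair_imset_proof s e : #|s @: val e| == 2.
Proof. by rewrite card_imset ?(valP e) //; apply: perm_inj. Qed.

Definition vpair_act s e : vpair n := Sub (s @: val e) (vpair_imset_proof s e).
Definition graph_act s G : graph n := vpair_act s @: G.

Lemma adjP G i j :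
  reflect (exists2 e, e \in G & val e = [set i; j]) (adj G i j).
Proof.
by apply: (iffP exists_inP) => [[e Ge /eqP eE]|[e Ge /eqP eE]]; exists e.
Qed.

Lemma adj_edge G i j e : val e = [set i; j] -> adj G i j = (e \in G).
Proof.
move=> eE; apply/adjP/idP => [[e' Ge' e'E]|Ge]; last by exists e.
by suff -> : e = e' by []; apply: val_inj; rewrite eE e'E.
Qed.

Lemma adj_sym G i j : adj G i j = adj G j i.
Proof. by rewrite /adj setUC. Qed.

Lemma adj_irr G i : adj G i i = false.
Proof.
apply/adjP => -[e _ eE]; have := valP e.
by rewrite eE setUid cards1.
Qed.

Lemma vpairP e : exists i j, val e = [set i; j].
Proof. by have /cards2P[i [j [_ eE]]] := valP e; exists i, j. Qed.

Lemma vpair_actM s t e : vpair_act s (vpair_act t e) = vpair_act (t * s) e.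
Proof.
apply: val_inj; rewrite /= -imset_comp; apply: eq_imset => i.
by rewrite /= permM.
Qed.

Lemma vpair_act1 e : vpair_act 1 e = e.
Proof.
apply: val_inj; rewrite /= -[RHS]imset_id.
by apply: eq_imset => i; rewrite perm1.
Qed.

Lemma graph_actM s t G : graph_act s (graph_act t G) = graph_act (t * s) G.
Proof.
rewrite /graph_act -imset_comp; apply: eq_imset => e; exact: vpair_actM.
Qed.

Lemma graph_act1 G : graph_act 1 G = G.
Proof. by rewrite -[RHS]imset_id; apply: eq_imset => e; rewrite vpair_act1. Qed.

Lemma vpair_act_inj s : injective (vpair_act s).
Proof.
apply: (can_inj (g := vpair_act s^-1)) => e.
by rewrite vpair_actM mulgV vpair_act1.
Qed.

Lemma adj_act s G i j : adj (graph_act s G) (s i) (s j) = adj G i j.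
Proof.
apply/adjP/adjP => [[_ /imsetP[e Ge ->] /= eE]|[e Ge eE]].
- exists e => //; apply: (imset_inj (@perm_inj _ s)).
  by rewrite eE imsetU1 imset_set1.
- exists (vpair_act s e); first exact: imset_f.
  by rewrite /= eE imsetU1 imset_set1.
Qed.

Lemma adj_actV s G i j : adj (graph_act s^-1 G) i j = adj G (s i) (s j).
Proof. by rewrite -(adj_act s) graph_actM mulVg graph_act1. Qed.

Lemma isomorphic_act s G : isomorphic G (graph_act s G).
Proof. by exists s => i j; apply: adj_act. Qed.

Lemma graph_of_rel_sub (R : rel 'I_n) G :
  (forall i j, R i j -> i != j -> adj G i j) -> graph_of_rel R \subset G.
Proof.
move=> RG; apply/subsetP => e; rewrite inE.
move=> /existsP[i /existsP[j /andP[/eqP eE Rij]]].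
rewrite -(adj_edge _ eE); apply: RG => //; have := valP e.
by rewrite eE cards2; case: (i != j).
Qed.

End GraphAction.

Lemma acyclic_perm_fixed n (K : comNzRingType) p (s : {perm 'I_n})
    (X : {set graph n}) :
  prime p -> (p%:R = 0 :> K)%R -> (s ^+ p)%g = 1%g ->
  {homo graph_act s : G / G \in X} -> acyclic (@proper_rel n) K X ->
  acyclic (@proper_rel n) K [set G in X | graph_act s G == G].
Proof.
move=> p_pr pK sp sX; apply: (acyclic_fixed (@proper_rel_irr n) p_pr pK) => //.
- exact/imset_inj/vpair_act_inj.
- move=> G H; rewrite /proper_rel; apply/idP/idP; last first.
    exact: imset_proper (in2W (@vpair_act_inj _ s)).
  move/(imset_proper (in2W (@vpair_act_inj _ s^-1))).
  by rewrite -!/(graph_act _ _) !graph_actM mulgV !graph_act1.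
- move=> G; have -> i : iter i (graph_act s) G = graph_act (s ^+ i) G.
    elim: i => [|i IHi] /=; first by rewrite expg0 graph_act1.
    by rewrite IHi graph_actM expgSr.
  by rewrite sp graph_act1.
(* A graph and its image have equally many edges, so neither properly contains the other. *)
- move=> G; rewrite /proper_rel; split; apply/negP => /proper_card;
    by rewrite card_imset ?ltnn //; apply: vpair_act_inj.
Qed.

(** * Two blocks of residues modulo [p] and their affine permutations *)

Section TwoBlocks.

Variable p : nat.
Hypothesis p_gt0 : 0 < p.

Lemma vertex_proof (b : bool) x : b * p + x %% p < 2 * p.
Proof.
apply: (@leq_trans (b * p + p)); first by rewrite ltn_add2l ltn_mod.
by case: b; rewrite mul2n -addnn ?mul1n // mul0n leq_addl.
Qed.

(* [false] stands for the block of vertices below [p]. *)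
Definition vertex b x : 'I_(2 * p) := Ordinal (vertex_proof b x).

Lemma eq_vertex b x b' y :
  (vertex b x == vertex b' y) = (b == b') && (x == y %[mod p]).
Proof.
rewrite -val_eqE /=; have [<-|bb'] := eqVneq b b'; first by rewrite eqn_add2l.
have [xp yp] := (ltn_pmod x p_gt0, ltn_pmod y p_gt0).
apply/negbTE/eqP => eq_xy.
by case: b b' bb' eq_xy => -[] //= _; rewrite mul0n mul1n add0n => E;
  [move: yp; rewrite -E | move: xp; rewrite E]; rewrite ltnNge leq_addr.
Qed.

Lemma vertex_mod b x y : x = y %[mod p] -> vertex b x = vertex b y.
Proof. by move=> xy; apply/eqP; rewrite eq_vertex eqxx xy /=. Qed.

Lemma vertexE (i : 'I_(2 * p)) : i = vertex (p <= i) i.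
Proof.
apply: val_inj => /=; case: leqP => [pi|ip]; last by rewrite modn_small.
rewrite mul1n -{2}(subnKC pi) modnDl modn_small ?subnKC //.
by rewrite ltn_subLR // addnn -mul2n.
Qed.

Lemma vertex_block b x : (p <= vertex b x) = b.
Proof. by case: b; rewrite /= ?mul1n ?leq_addr // leqNgt ltn_pmod. Qed.

Lemma eqn_mod_mul2l a x y :
  coprime p a -> (a * x == a * y %[mod p]) = (x == y %[mod p]).
Proof.
move=> co; wlog yx : x y / y <= x.
  move=> wl; case: (leqP y x) => [/wl //|/ltnW/wl].
  by rewrite eq_sym => ->; rewrite eq_sym.
by rewrite !eqn_mod_dvd ?leq_mul2l ?yx ?orbT // -mulnBr Gauss_dvdr.
Qed.

(** Injective because each [a b] is invertible modulo [p]. The instances used are the rotations, the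
    swap of the blocks and a rescaling of each block. *)
Lemma block_perm (w : bool) (a c : bool -> nat) :
  (forall b, coprime p (a b)) ->
  exists s : {perm 'I_(2 * p)},
    forall b x, s (vertex b x) = vertex (w (+) b) (a b * x + c b).
Proof.
move=> co; pose f (i : 'I_(2 * p)) :=
  vertex (w (+) (p <= i)) (a (p <= i) * i + c (p <= i)).
have fE b x : f (vertex b x) = vertex (w (+) b) (a b * x + c b).
  rewrite /f vertex_block; apply: vertex_mod; apply/eqP.
  rewrite eqn_modDr eqn_mod_mul2l //=.
  by case: b; rewrite ?mul1n ?mul0n ?add0n ?modnDl modn_mod.
have f_inj : injective f.
  move=> i j; rewrite [i]vertexE [j]vertexE !fE => /eqP; rewrite eq_vertex.
  case/andP=> /eqP/addbI <-; rewrite eqn_modDr eqn_mod_mul2l // => /eqP.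
  exact: vertex_mod.
by exists (perm f_inj) => b x; rewrite permE.
Qed.

Lemma eq_block_perm (s t : {perm 'I_(2 * p)}) :
  (forall b x, s (vertex b x) = t (vertex b x)) -> s = t.
Proof. by move=> st; apply/permP => i; rewrite [i]vertexE. Qed.

End TwoBlocks.

(** * Graphs invariant under the block rotations *)

Section Invariant.

Variables (p : nat) (p_pr : prime p).

Let p_gt0 : 0 < p := prime_gt0 p_pr.

Local Notation v := (vertex p_gt0).

Lemma coprime_1 (b : bool) : coprime p ((fun=> 1) b).
Proof. exact: coprimen1. Qed.

Lemma block_rotations : exists rho : bool -> {perm 'I_(2 * p)},
  forall k b x, rho k (v b x) = v b (x + (b == k)).
Proof.
have rot k : exists s : {perm 'I_(2 * p)},
    forall b x, s (v b x) = v b (x + (b == k)).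
  have [s sE] := block_perm p_gt0 false (fun b => b == k : nat) coprime_1.
  by exists s => b x; rewrite sE mul1n.
have [[s sE] [t tE]] := (rot true, rot false).
by exists (fun k => if k then s else t) => -[].
Qed.

Lemma block_swap : exists s : {perm 'I_(2 * p)},
  forall b x, s (v b x) = v (~~ b) x.
Proof.
have [s sE] := block_perm p_gt0 true (fun=> 0) coprime_1.
by exists s => b x; rewrite sE mul1n addn0.
Qed.

Variable rho : bool -> {perm 'I_(2 * p)}.
Hypothesis rhoE : forall k b x, rho k (v b x) = v b (x + (b == k)).

Definition invariant (G : graph (2 * p)) := forall k, graph_act (rho k) G = G.

Lemma rho_order k : (rho k ^+ p)%g = 1%g.
Proof.
have rhoX i b x : (rho k ^+ i)%g (v b x) = v b (x + (b == k) * i).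
  elim: i => [|i IHi]; first by rewrite muln0 addn0 expg0 perm1.
  by rewrite expgSr permM IHi rhoE mulnS addnA addnAC.
apply: (eq_block_perm (p_gt0 := p_gt0)) => b x; rewrite rhoX perm1.
by apply: vertex_mod; rewrite addnC modnMDl.
Qed.

Lemma rhoC k l : (rho k * rho l)%g = (rho l * rho k)%g.
Proof.
apply: (eq_block_perm (p_gt0 := p_gt0)) => b x.
by rewrite !permM !rhoE addnAC.
Qed.

(** The swap conjugates each block rotation into the other one. *)
Lemma swap_invariant (s : {perm 'I_(2 * p)}) G :
  (forall b x, s (v b x) = v (~~ b) x) -> invariant G ->
  invariant (graph_act s G).
Proof.
move=> sE invG k; rewrite graph_actM -{2}(invG (~~ k)) graph_actM.
congr graph_act; apply: (eq_block_perm (p_gt0 := p_gt0)) => b x.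
by rewrite !permM sE !rhoE sE; case: b k => -[].
Qed.

Section InvariantGraph.

Variable G : graph (2 * p).
Hypothesis invG : invariant G.

Lemma adj_shift k i b x b' y : adj G (v b x) (v b' y) =
  adj G (v b (x + (b == k) * i)) (v b' (y + (b' == k) * i)).
Proof.
elim: i => [|i ->]; first by rewrite !muln0 !addn0.
rewrite -[LHS](adj_act (rho k)) invG !rhoE.
by rewrite !mulnS !addnA -![_ + _ * i + _]addnAC.
Qed.

(** [z + (p - x %% p)] stands for the residue [z - x] within the natural numbers. *)
Lemma modn_shift x z : x + (z + (p - x %% p)) = z %[mod p].
Proof.
by rewrite -modnDml addnCA subnKC 1?ltnW ?ltn_pmod // modnDr.
Qed.

(** Rotating the blocks independently carries any cross pair to any other. *)
Lemma adj_cross x y x' y' :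
  adj G (v false x) (v true y) -> adj G (v false x') (v true y').
Proof.
rewrite (adj_shift false (x' + (p - x %% p))).
rewrite (adj_shift true (y' + (p - y %% p))) /= !mul0n !addn0 !mul1n.
rewrite (vertex_mod _ _ (modn_shift x x')).
by rewrite (vertex_mod _ _ (modn_shift y y')).
Qed.

Lemma adj_circulant b x y : adj G (v b x) (v b y) ->
  exists2 d, coprime p d & forall z, adj G (v b z) (v b (z + d)).
Proof.
(* The step [d] represents [y - x], nonzero modulo the prime [p] because there are no loops. *)
move=> xy; exists (y + (p - x %% p)); last first.
  move=> z; move: xy; rewrite (adj_shift b (z + (p - x %% p))) eqxx !mul1n.
  by rewrite (vertex_mod _ _ (modn_shift x z)) addnCA.
rewrite prime_coprime //; apply/negP => pd.
have /(vertex_mod p_gt0 b) E : x = y %[mod p].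
  rewrite -[in RHS](modn_shift x y) -modnDmr (eqP pd).
  by rewrite addn0.
by rewrite E adj_irr in xy.
Qed.

Definition has_block_edge b :=
  [exists i : 'I_(2 * p), exists j : 'I_(2 * p),
    [&& (p <= i) == b, (p <= j) == b & adj G i j]].

Lemma block_edgeP b :
  reflect (exists x y, adj G (v b x) (v b y)) (has_block_edge b).
Proof.
apply: (iffP existsP) => [[i /existsP[j]]|[x [y xy]]].
  case/and3P=> /eqP ib /eqP jb ij.
  by exists i, j; rewrite -{1}ib -jb -!vertexE.
by exists (v b x); apply/existsP; exists (v b y); rewrite !vertex_block eqxx.
Qed.

Lemma complete_bipartite_sub x y :
  adj G (v false x) (v true y) -> complete_bipartite p \subset G.
Proof.
move=> xy; apply: graph_of_rel_sub => i j /andP[ip pj] _.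
rewrite (vertexE p_gt0 i) (vertexE p_gt0 j) pj leqNgt ip.
exact: adj_cross xy.
Qed.

(** Pairs at a fixed distance coprime to [p] form a cycle through the block; dividing labels by that
    distance, in each block separately, makes them consecutive. *)
Lemma two_cycles_sub : has_block_edge false -> has_block_edge true ->
  exists s : {perm 'I_(2 * p)}, two_cycles p \subset graph_act s G.
Proof.
move=> /block_edgeP[x0 [y0 /adj_circulant[d0 co0 d0E]]].
move=> /block_edgeP[x1 [y1 /adj_circulant[d1 co1 d1E]]].
have co b : coprime p ((fun b => if b then d1 else d0) b) by case: b.
have [s sE] := block_perm p_gt0 false (fun=> 0) co.
exists s^-1%g; apply: graph_of_rel_sub => i j /andP[ij /eqP ji] _.
rewrite adj_actV (vertexE p_gt0 i) (vertexE p_gt0 j).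
have -> : (p <= j) = (p <= i) by rewrite leqNgt -(eqP ij) -leqNgt.
rewrite (vertex_mod _ _ ji) !sE /= !addn0 mulnS addnC.
by case: (p <= i); [exact: d1E | exact: d0E].
Qed.

End InvariantGraph.

Lemma block_edge_swap (s : {perm 'I_(2 * p)}) G (b : bool) :
  (forall b' x, s (v b' x) = v (~~ b') x) ->
  has_block_edge (graph_act s G) b = has_block_edge G (~~ b).
Proof.
move=> sE; apply/block_edgeP/block_edgeP => -[x [y xy]]; exists x, y.
  by rewrite -(adj_act s) !sE negbK.
by move: xy; rewrite -(adj_act s) !sE negbK.
Qed.

End Invariant.

Theorem proposition4p5 (p : nat) (P : {set graph (2 * p)})
    (hp : prime p) (hodd : odd p) (hP : graph_property P)
    (hnt : nontrivial P) (hmono : monotone P) (hne : ~ evasive P) :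
  two_cycles p \in P \/ complete_bipartite p \in P.
Proof.
apply/orP/negPn; rewrite negb_or; apply/negP => /andP[noC noK].
have P0 : P != set0 by apply/eqP => P0; apply: hnt; left.
pose p_gt0 := prime_gt0 hp; pose v := vertex p_gt0.
have [rho rhoE] := block_rotations hp.
have [s sE] := block_swap hp.
pose K : comNzRingType := 'F_p.
have pK : (p%:R = 0 :> K)%R by apply: (pcharf0 (pchar_Fp hp)).
pose X := P :\ set0.
pose Y := [set G in [set G in X | graph_act (rho false) G == G]
            | graph_act (rho true) G == G].
have Xact t : {homo graph_act t : G / G \in X}.
  move=> G; rewrite !inE => /andP[G0 PG].
  by rewrite imset_eq0 G0 (hP _ _ (isomorphic_act t G)).
have acY : acyclic (@proper_rel (2 * p)) K Y.
  apply: (acyclic_perm_fixed hp pK (rho_order rhoE true)).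
    (* [rho true] preserves the graphs fixed by [rho false] because the rotations commute. *)
    move=> G; rewrite inE => /andP[XG /eqP fG].
    by rewrite inE Xact //= graph_actM (rhoC rhoE) -graph_actM fG.
  apply: (acyclic_perm_fixed hp pK (rho_order rhoE false)) => //.
  exact: nonevasive_acyclic.
have YP G : reflect [/\ G \in P, G != set0 & invariant rho G] (G \in Y).
  rewrite !inE; apply: (iffP andP) => [[/andP[/andP[G0 PG]]]|[PG G0 fG]].
    by move=> /eqP f0 /eqP f1; split=> // -[].
  by rewrite G0 PG !fG eqxx.
(* [noC] forbids edges in both blocks at once; [noK] forbids cross edges, so that a nonempty graph
   has an edge in some block. *)
have edge G : G \in Y -> has_block_edge G true = ~~ has_block_edge G false.
  case/YP=> PG G0 fG; apply/idP/idP => [h1|/negP h0].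
    apply: contra noC => h0; have [t sub] := two_cycles_sub rhoE fG h0 h1.
    exact: hmono (hP _ _ (isomorphic_act t G) PG) sub.
  have nocross x y : ~~ adj G (v false x) (v true y).
    apply: contra noK => /(complete_bipartite_sub rhoE fG).
    exact: hmono.
  have /set0Pn[e Ge] := G0; have [i [j eE]] := vpairP e.
  rewrite -(adj_edge _ eE) (vertexE p_gt0 i) (vertexE p_gt0 j) in Ge.
  case: (p <= i) Ge; case: (p <= j) => Ge.
  - by apply/(block_edgeP hp); exists i, j.
  - by rewrite adj_sym (negPf (nocross _ _)) in Ge.
  - by rewrite (negPf (nocross _ _)) in Ge.
  - by case: h0; apply/(block_edgeP hp); exists i, j.
have /set0Pn[G YG] := acyclic_neq0 acY.
have YsG : graph_act s G \in Y.
  have /YP[PG G0 fG] := YG; apply/YP; split.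
  - exact: hP (isomorphic_act s G) PG.
  - by rewrite imset_eq0.
  - exact (swap_invariant rhoE sE fG).
have edge_mono (b : bool) (A B : graph (2 * p)) :
    A \subset B -> has_block_edge A b -> has_block_edge B b.
  move=> /subsetP AB /(block_edgeP hp)[x [y /adjP[e Ae eE]]].
  by apply/(block_edgeP hp); exists x, y; apply/adjP; exists e; first exact: AB.
(* [phi] records which block carries the edges: it is constant along inclusions in [Y], yet the swap
   exchanges its values 0 and 1. *)
pose phi (A : graph (2 * p)) : K := (has_block_edge A false)%:R%R.
have eqE : phi G = phi (graph_act s G).
  apply: (acyclic_connected (@proper_rel_irr _) acY) => // A B YA YB.
  move=> /proper_sub AB; congr (_%:R)%R; congr nat_of_bool.
  apply/idP/idP; first exact: edge_mono.
  (* Contraposition passes to the other block, where inclusion again preserves edges. *)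
  apply: contraLR; rewrite -!edge //; exact: edge_mono.
move: eqE; rewrite /phi (block_edge_swap _ _ sE) edge //.
have /eqP K1 := oner_neq0 K.
by case: has_block_edge => [/K1 | /esym/K1].
Qed.
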